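(* Let $m \ge 2$ have prime factor decomposition $m = p_1^{k_1} \cdots p_h^{k_h}$, and let $T_{f[-r,r]}$ be the one-dimensional linear cellular automaton on $\mathbb{Z}_m^{\mathbb{Z}}$ with local rule $f(x_{-r},\dots,x_r) = \sum_{i=-r}^{r} \lambda_i x_i \pmod m$. For $i=1,\dots,h$ define $P_i = \{0\} \cup \{j : \gcd(\lambda_j, p_i) = 1\}$, $L_i = \min P_i$, $R_i = \max P_i$, $\theta_{L_i} = \operatorname{arccot}(-L_i)$ and $\theta_{R_i} = \operatorname{arccot}(-R_i)$. Then the topological directional entropy $h(\theta)$ of the $\mathbb{Z}^2$-action generated by the pair $(T_{f[-r,r]}, \sigma)$ in the direction $\theta \in [0,\pi]$ is $$h(\theta) = \sum_{i=1}^{h} h_i(\theta), \qquad h_i(\theta) = \begin{cases} k_i(\cos\theta + R_i \sin\theta)\ln p_i, & \theta \in [0,\theta_{L_i}],\\ k_i (R_i - L_i)\sin\theta \ln p_i, & \theta \in [\theta_{L_i}, \theta_{R_i}],\\ k_i(\cos\theta + L_i\sin\theta)\ln p_i, & \theta \in [\theta_{R_i}, \pi].\end{cases}$$ That is, sector by sector: $h(\theta) = \sum_{i=1}^h k_i(\cos\theta + R_i\sin\theta)\ln p_i$ for $\theta \in [0, \min_i \theta_{L_i}]$; if the minimum $\min_i\theta_{L_i}$ is attained at the single index $j$, then $h(\theta) = \sum_{i\ne j} k_i(\cos\theta + R_i\sin\theta)\ln p_i + k_j(R_j-L_j)\sin\theta\ln p_j$ for $\theta$ between $\theta_{L_j}$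 and the next sector boundary $\min\{\theta_{R_j}, \min_{i\neq j}\theta_{L_i}\}$; and so on through the successive sectors, until finally $h(\theta) = \sum_{i=1}^h k_i(\cos\theta + L_i\sin\theta)\ln p_i$ for $\theta \in [\max_i \theta_{R_i}, \pi]$.
   Context: $\mathbb{Z}_m = \mathbb{Z}/m\mathbb{Z}$; $\mathbb{Z}_m^{\mathbb{Z}}$ carries the product topology; $\sigma$ is the shift $(\sigma x)_n = x_{n+1}$. The linear cellular automaton with local rule $f(x_{-r},\dots,x_r) = \sum_{i=-r}^r \lambda_i x_i \pmod m$, $\lambda_i \in \mathbb{Z}_m$, is $(T_{f[-r,r]}x)_n = \sum_{i=-r}^r \lambda_i x_{n+i} \pmod m$; it commutes with $\sigma$. The function $\operatorname{arccot}$ takes values in $(0,\pi)$. Topological directional entropy (Milnor) of the action generated by a cellular automaton $T$ and $\sigma$, in the direction $\theta \in [0,\pi]$: for $x \in \mathbb{Z}_m^{\mathbb{Z}}$ let $y^x : \mathbb{Z} \times \mathbb{Z}_{\ge 0} \to \mathbb{Z}_m$, $y^x(i,j) = (T^j x)_i = (\sigma^i T^j x)_0$, be its space-time diagram. For a bounded set $E \subset \mathbb{R} \times [0,\infty)$ let $N(E)$ be the number of distinct restrictions of the diagrams $y^x$, $x \in \mathbb{Z}_m^{\mathbb{Z}}$, to $E \cap \mathbb{Z}^2$. With $v_\theta = (\cos\theta, \sin\theta)$, $$h(\theta) = \sup_{B} \limsup_{t \to \infty} \frac{1}{t} \ln N\big(B + \{s v_\theta : 0 \le s \le t\}\big),$$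 where the supremum is over bounded sets $B \subset \mathbb{R} \times [0,\infty)$.
   Formalization: The third-sector formula is taken with a minus sign, −k_i(cos θ + L_i sin θ) ln p_i; and each p_i is required to have some j ≥ 0 with gcd(λ_j, p_i) = 1 when 0 < θ < π/2, and some j ≤ 0 when π/2 < θ < π; otherwise the formula is false. *)

(* Defs.v *)
(* MathComp-Analysis *)
From mathcomp Require Import all_boot all_order all_algebra finmap.
From mathcomp Require Import all_classical all_reals all_analysis.

Set Implicit Arguments.
Unset Strict Implicit.
Unset Printing Implicit Defensive.

Import Order.TTheory GRing.Theory Num.Theory.
Import numFieldNormedType.Exports.

Local Open Scope classical_set_scope.
Local Open Scope ring_scope.

(* A local rule of radius r is lam : 'I_(2 * r).+1 -> 'Z_m; position k of the
   array carries the coefficient lambda_j with j = offset k in [-r, r]. *)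
Definition offset (r : nat) (k : 'I_(2 * r).+1) : int := k%:Z - r%:Z.

Definition linear_ca (m r : nat) (lam : 'I_(2 * r).+1 -> 'Z_m)
    (x : int -> 'Z_m) : int -> 'Z_m :=
  fun n => \sum_(k < (2 * r).+1) lam k * x (n + offset k).

Definition spacetime (A : choiceType) (T : (int -> A) -> (int -> A)) (x : int -> A)
    : int * nat -> A :=
  fun q => iter q.2 T x q.1.

Definition lattice_points (R : realType) (E : set (R * R)) : set (int * nat) :=
  [set q | E (q.1%:~R, q.2%:R)].

(* fset_set is the finite set with the same elements when, as for bounded E and
   finite A, there are finitely many patterns (it is empty otherwise). *)
Definition num_patterns (R : realType) (A : choiceType)
    (T : (int -> A) -> (int -> A)) (E : set (R * R)) : nat :=
  #|` fset_set (range (fun x : int -> A =>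
        sigL (lattice_points E) (spacetime T x))) |.

Definition sweep (R : realType) (theta : R) (B : set (R * R)) (t : R)
    : set (R * R) :=
  [set q | exists2 b, B b & exists2 s, 0 <= s <= t &
     q = (b.1 + s * cos theta, b.2 + s * sin theta)].

Definition directional_entropy (R : realType) (A : choiceType)
    (T : (int -> A) -> (int -> A)) (theta : R) : \bar R :=
  ereal_sup [set limf_esup
      (fun t : R => (t^-1 * ln (num_patterns T (sweep theta B t))%:R)%:E) (pinfty_nbhs R)
    | B in [set B : set (R * R) |
              bounded_set B /\ B `<=` [set q | 0 <= q.2]]].

(* The branch of the inverse cotangent with values in (0, pi). *)
Definition arccot (R : realType) (x : R) : R := pi / 2 - atan x.

Definition invertible_offsets (m r : nat) (lam : 'I_(2 * r).+1 -> 'Z_m)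
    (p : nat) : seq int :=
  [seq offset k | k <- enum 'I_(2 * r).+1 & coprime (lam k) p].

(* Adjoining 0 overestimates the entropy in some non-axis directions when no
   invertible offset is >= 0 (directions below pi / 2) or none is <= 0
   (directions above pi / 2): for the shift, the only invertible offset is 1 and
   the entropy vanishes at 3 * pi / 4. Hence the hypotheses on
   invertible_offsets in the theorem. *)
Definition P_set (m r : nat) (lam : 'I_(2 * r).+1 -> 'Z_m) (p : nat)
    : seq int := 0 :: invertible_offsets lam p.

(* As 0 belongs to P_set, taking 0 as the initial value of the iterated minimum
   and maximum is harmless. *)
Definition L_end (m r : nat) (lam : 'I_(2 * r).+1 -> 'Z_m) (p : nat) : int :=
  \big[Num.min/0]_(j <- P_set lam p) j.

Definition R_end (m r : nat) (lam : 'I_(2 * r).+1 -> 'Z_m) (p : nat) : int :=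
  \big[Num.max/0]_(j <- P_set lam p) j.

Definition theta_of (R : realType) (j : int) : R := arccot (- j%:~R).

Definition h_first (R : realType) (Re : int) (p k : nat) (theta : R) : R :=
  k%:R * (cos theta + Re%:~R * sin theta) * ln p%:R.

Definition h_middle (R : realType) (Le Re : int) (p k : nat) (theta : R) : R :=
  k%:R * (Re - Le)%:~R * sin theta * ln p%:R.

(* In the last sector cos theta + Le * sin theta <= 0; the contribution to
   the entropy is k * ln p times the absolute value of this number. *)
Definition h_last (R : realType) (Le : int) (p k : nat) (theta : R) : R :=
  k%:R * - (cos theta + Le%:~R * sin theta) * ln p%:R.

Definition h_sector (R : realType) (Le Re : int) (p k : nat) (theta : R) : R :=
  if theta <= theta_of R Le then h_first Re p k theta
  else if theta <= theta_of R Re then h_middle Le Re p k theta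
  else h_last Le p k theta.

(* Main.v *)
Require Import Defs.
From mathcomp Require Import all_boot all_order all_algebra finmap.
From mathcomp Require Import all_classical all_reals all_analysis.
From mathcomp Require Import zify ring lra.
Import Order.TTheory GRing.Theory Num.Theory.
Import numFieldNormedType.Exports.
Local Open Scope ring_scope.
Set Implicit Arguments.
Unset Strict Implicit.
Unset Printing Implicit Defensive.

(* Write a_i = max(cos theta + R_i sin theta, 0) and
   b_i = min(cos theta + L_i sin theta, 0). In each of the three sectors h_i is
   k_i (a_i - b_i) ln p_i, and the entropy is shown to be the sum of these.
   Upper bound: modulo p^k, coefficients divisible by p can be used fewer than k
   times along a path, so the pattern on a swept set is determined, modulo each
   p_i^k_i, by the window [t b_i - C, t a_i + C] of row 0.
   Lower bound: take configurations whose p_i-primary part is supported on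
   [t b_i, t a_i]. If such a configuration is divisible by p^a and its pattern
   vanishes modulo p^(a+1), then, the extremal coefficients being units mod p,
   the sites of the window are forced to vanish modulo p^(a+1) one after the
   other, going outwards; by induction on a the configuration is zero. Counting
   through this p-adic filtration avoids splitting Z_m by the Chinese remainder
   theorem. *)

(** * Divisibility of residues in ['Z_m] *)

Lemma dvdn_modE (d m n : nat) : (d %| m)%N -> (d %| n %% m)%N = (d %| n)%N.
Proof. by move=> dm; rewrite /dvdn modn_dvdm. Qed.

(** Tests the representative in [0, m). This is a property of the residue class exactly when d
    divides m, hence the hypothesis [d %| m] in the lemmas below. *)
Definition Zdvd (m d : nat) (x : 'Z_m) : bool := (d %| x)%N.

Lemma Zdvd_mulE (m d : nat) (x y : 'Z_m) :
  (1 < m)%N -> (d %| m)%N -> Zdvd d (x * y) = (d %| x * y)%N.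
Proof. by case: m x y => [|[|m]] //= x y _ /dvdn_modE dm; rewrite /Zdvd /= dm. Qed.

Lemma Zdvd0 (m d : nat) : Zdvd d (0 : 'Z_m).
Proof. exact: dvdn0. Qed.

Lemma ZdvdD (m d : nat) (x y : 'Z_m) :
  (1 < m)%N -> (d %| m)%N -> Zdvd d x -> Zdvd d y -> Zdvd d (x + y).
Proof.
case: m x y => [|[|m]] //= x y _ /dvdn_modE dm; rewrite /Zdvd /= dm.
exact: dvdn_add.
Qed.

Lemma ZdvdN (m d : nat) (x : 'Z_m) :
  (1 < m)%N -> (d %| m)%N -> Zdvd d x -> Zdvd d (- x).
Proof.
case: m x => [|[|m]] //= x _ dm dx; rewrite /Zdvd /= (dvdn_modE _ dm).
by rewrite dvdn_subr // ltnW // ltn_ord.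
Qed.

Lemma ZdvdB (m d : nat) (x y : 'Z_m) :
  (1 < m)%N -> (d %| m)%N -> Zdvd d x -> Zdvd d y -> Zdvd d (x - y).
Proof. by move=> m1 dm dx dy; apply: ZdvdD => //; apply: ZdvdN. Qed.

Lemma Zdvd_sum (m d : nat) (I : Type) (s : seq I) (P : pred I) (F : I -> 'Z_m) :
  (1 < m)%N -> (d %| m)%N -> (forall i, P i -> Zdvd d (F i)) ->
  Zdvd d (\sum_(i <- s | P i) F i).
Proof.
move=> m1 dm dF; elim/big_ind: _ => //; first exact: Zdvd0.
by move=> x y; apply: ZdvdD.
Qed.

Lemma ZdvdM (m d1 d2 : nat) (x y : 'Z_m) :
  (1 < m)%N -> (d1 * d2 %| m)%N -> Zdvd d1 x -> Zdvd d2 y ->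
  Zdvd (d1 * d2) (x * y).
Proof. by move=> m1 dm dx dy; rewrite Zdvd_mulE //; apply: dvdn_mul. Qed.

Lemma ZdvdMl (m d : nat) (x y : 'Z_m) :
  (1 < m)%N -> (d %| m)%N -> Zdvd d y -> Zdvd d (x * y).
Proof. by move=> m1 dm dy; rewrite Zdvd_mulE //; apply: dvdn_mull. Qed.

Lemma Zdvd_Gauss (m d : nat) (x y : 'Z_m) :
  (1 < m)%N -> (d %| m)%N -> coprime d x -> Zdvd d (x * y) = Zdvd d y.
Proof. by move=> m1 dm dx; rewrite Zdvd_mulE // Gauss_dvdr. Qed.

Lemma Zdvd_GaussX (m d j : nat) (x y : 'Z_m) :
  (1 < m)%N -> (d %| m)%N -> coprime d x -> Zdvd d (x ^+ j * y) = Zdvd d y.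
Proof.
move=> m1 dm dx; elim: j => [|j IH]; first by rewrite expr0 mul1r.
by rewrite exprS -mulrA Zdvd_Gauss.
Qed.

Lemma Zdvd_nat (m d n : nat) :
  (1 < m)%N -> (d %| m)%N -> Zdvd d (n%:R : 'Z_m) = (d %| n)%N.
Proof. by move=> m1 dm; rewrite /Zdvd val_Zp_nat // dvdn_modE. Qed.

Lemma ZdvdW (m d1 d2 : nat) (x : 'Z_m) :
  (d1 %| d2)%N -> Zdvd d2 x -> Zdvd d1 x.
Proof. exact: dvdn_trans. Qed.

Lemma Zdvd_max (m : nat) (x : 'Z_m) : (1 < m)%N -> Zdvd m x -> x = 0.
Proof.
case: m x => [|[|m]] //= x _ dx; apply/val_inj => /=.
have xl : (x < m.+2)%N by exact: ltn_ord x.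
apply/eqP; rewrite -leqn0 leqNgt; apply/negP => x0.
by have := dvdn_leq x0 dx; rewrite leqNgt xl.
Qed.

(** * Linearity of the automaton *)

Lemma linear_caB (m r : nat) (lam : 'I_(2 * r).+1 -> 'Z_m) (x y : int -> 'Z_m) :
  linear_ca lam (fun u => x u - y u) =
  (fun n => linear_ca lam x n - linear_ca lam y n).
Proof.
apply/funext => n; rewrite /linear_ca -sumrB.
by apply: eq_bigr => k _; rewrite mulrBr.
Qed.

Lemma iter_linear_caB (m r : nat) (lam : 'I_(2 * r).+1 -> 'Z_m) (j : nat)
    (x y : int -> 'Z_m) :
  iter j (linear_ca lam) (fun u => x u - y u) =
  (fun n => iter j (linear_ca lam) x n - iter j (linear_ca lam) y n).
Proof. by elim: j => [//|j IH]; rewrite !iterS IH linear_caB. Qed.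

Lemma offset_bound (r : nat) (i : 'I_(2 * r).+1) : - r%:Z <= offset i <= r%:Z.
Proof. by rewrite /offset; have := ltn_ord i; lia. Qed.

(** * Dependence of the iterates on row 0 modulo powers of p *)

Section Locality.
Variables (m r p : nat) (lam : 'I_(2 * r).+1 -> 'Z_m) (L R : int).
Hypotheses (m_gt1 : (1 < m)%N) (p_pr : prime p).
Hypothesis unit_range :
  forall i, coprime (lam i) p -> L <= offset i <= R.

Let nonunit i : ~~ coprime (lam i) p -> Zdvd p (lam i).
Proof. by rewrite coprime_sym prime_coprime // negbK. Qed.

(* The light cone of a nonunit coefficient may leave [L, R], but each use of
   such a coefficient gains a factor p, so at most a of them matter. *)
Lemma iter_locality (a j : nat) (x : int -> 'Z_m) (n : int) :
  L <= r%:Z -> - r%:Z <= R -> (p ^ a %| m)%N ->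
  (forall u, n + j%:Z * L - (2 * r * a)%:Z <= u <= n + j%:Z * R + (2 * r * a)%:Z ->
     Zdvd (p ^ a) (x u)) ->
  Zdvd (p ^ a) (iter j (linear_ca lam) x n).
Proof.
move=> Lr rR; elim: j a n => [|j IH] a n dm xw /=.
  by apply: xw; lia.
apply: Zdvd_sum => // i _; have := offset_bound i.
case: (boolP (coprime (lam i) p)) => [/unit_range LiR|/nonunit pl] ob.
  by apply: ZdvdMl => //; apply: IH => // u ub; apply: xw; nia.
case: a dm xw => [|a] dm xw; first by rewrite expn0 /Zdvd dvd1n.
(* The coefficient supplies one factor p, so the remaining steps need only p^a. The margin shrinks
   by 2r, which absorbs the excursion: [offset i] and the ends L, R differ by at most 2r in the
   relevant direction. *)
rewrite expnS in dm *; apply: ZdvdM => //; apply: IH.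
  exact: dvdn_trans (dvdn_mull _ _) dm.
move=> u ub; apply: ZdvdW (xw u _); first by rewrite expnS dvdn_mull.
by nia.
Qed.

(** * One layer of the p-adic filtration: configurations divisible by p^a, read modulo p^(a+1) *)

Section Layer.
Variables (a : nat) (x : int -> 'Z_m).
Hypotheses (dm : (p ^ a.+1 %| m)%N) (xa : forall u, Zdvd (p ^ a) (x u)).

Let pam : (p ^ a %| m)%N.
Proof. by apply: dvdn_trans dm; rewrite expnS dvdn_mull. Qed.

Let iter_xa j n : Zdvd (p ^ a) (iter j (linear_ca lam) x n).
Proof.
elim: j n => [//|j IH] n /=.
by apply: Zdvd_sum => // i _; apply: ZdvdMl.
Qed.

(** As x is divisible by p^a, a single nonunit coefficient already kills its term. Only unit
    coefficients propagate, and the dependency cone needs no margin. *)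
Lemma iter_locality_layer (j : nat) (n : int) :
  (forall u, n + j%:Z * L <= u <= n + j%:Z * R -> Zdvd (p ^ a.+1) (x u)) ->
  Zdvd (p ^ a.+1) (iter j (linear_ca lam) x n).
Proof.
elim: j n => [|j IH] n xw /=; first by apply: xw; lia.
apply: Zdvd_sum => // i _.
case: (boolP (coprime (lam i) p)) => [/unit_range LiR|/nonunit pl].
  by apply: ZdvdMl => //; apply: IH => // u ub; apply: xw; nia.
by rewrite expnS; apply: ZdvdM => //; rewrite -expnS.
Qed.

(** The only path of units from row j to the extremal site uses [lam e] at every step; every other
    path ends where x vanishes or passes through a nonunit. *)
Lemma iter_extremal (e : 'I_(2 * r).+1) (j : nat) (n : int) :
  coprime (lam e) p -> offset e = L \/ offset e = R ->
  (forall u, n + j%:Z * L <= u <= n + j%:Z * R -> u != n + j%:Z * offset e ->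
     Zdvd (p ^ a.+1) (x u)) ->
  Zdvd (p ^ a.+1)
    (iter j (linear_ca lam) x n - lam e ^+ j * x (n + j%:Z * offset e)).
Proof.
move=> ce eLR; elim: j n => [|j IH] n xw.
  by rewrite mul0r addr0 expr0 mul1r subrr Zdvd0.
rewrite iterS {1}/linear_ca (bigD1 e) //= addrAC exprS -mulrA -mulrBr.
apply: ZdvdD => //.
  apply: ZdvdMl => //.
  rewrite (_ : n + j.+1%:Z * offset e = n + offset e + j%:Z * offset e);
    last by rewrite intS mulrDl mul1r addrA.
  have := unit_range ce => LeR.
  by apply: IH => u ub ue; apply: xw; nia.
apply: Zdvd_sum => // i ie.
case: (boolP (coprime (lam i) p)) => [/unit_range LiR|/nonunit pl].
  (* A first step along another offset leads to a cone that misses the extremal site. *)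
  have oie : offset i != offset e.
    by apply: contraNneq ie => oe; apply/eqP/ord_inj; move: oe; rewrite /offset; lia.
  by apply: ZdvdMl => //; apply: iter_locality_layer => u ub; apply: xw; nia.
by rewrite expnS; apply: ZdvdM => //; rewrite -expnS.
Qed.

(** The power of the unit [lam e] cancels, so the outermost site can be read off from row j. *)
Lemma extremal_site (e : 'I_(2 * r).+1) (j : nat) (n : int) :
  coprime (lam e) p -> offset e = L \/ offset e = R ->
  (forall u, n + j%:Z * L <= u <= n + j%:Z * R -> u != n + j%:Z * offset e ->
     Zdvd (p ^ a.+1) (x u)) ->
  Zdvd (p ^ a.+1) (iter j (linear_ca lam) x n) ->
  Zdvd (p ^ a.+1) (x (n + j%:Z * offset e)).
Proof.
move=> ce eLR xw dT; rewrite -(@Zdvd_GaussX _ _ j (lam e)) //; last first.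
  by rewrite coprimeXl // coprime_sym.
have := ZdvdB m_gt1 dm dT (iter_extremal ce eLR xw).
by rewrite subKr.
Qed.

End Layer.
End Locality.

(** * From a zero pattern on a strip to zeros in row 0 *)

Section Propagation.
Variables (R : realType) (m r p : nat) (lam : 'I_(2 * r).+1 -> 'Z_m) (l u : int).
Variables (c s t : R).
Hypotheses (m_gt1 : (1 < m)%N) (p_pr : prime p).
Hypothesis unit_range : forall i, coprime (lam i) p -> l <= offset i <= u.
Hypotheses (l_ge : - r%:Z <= l) (lu : l <= u) (u_le : u <= r%:Z).
Hypotheses (c_ge : -1 <= c) (c_le : c <= 1) (s_ge0 : 0 <= s) (s_le1 : s <= 1).

(* A zero pattern on a strip leaving the origin in the direction (c, s) forces
   x to vanish on an interval of row 0 whose ends move at these speeds. *)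
Definition right_speed : R := Num.max (c + u%:~R * s) 0.
Definition left_speed : R := Num.min (c + l%:~R * s) 0.

Hypothesis right_unit : 0 < s -> 0 < right_speed ->
  exists2 e, coprime (lam e) p & offset e = u.
Hypothesis left_unit : 0 < s -> left_speed < 0 ->
  exists2 e, coprime (lam e) p & offset e = l.

Variables (a : nat) (x : int -> 'Z_m).
Hypotheses (dm : (p ^ a.+1 %| m)%N) (xa : forall v, Zdvd (p ^ a) (x v)).
Hypothesis vanish : forall (n : int) (j : nat) (tau : R), 0 <= tau <= t ->
  `|n%:~R - tau * c| <= (4 * r + 2)%:R -> 0 <= j%:R - tau * s <= 1 ->
  Zdvd (p ^ a.+1) (iter j (linear_ca lam) x n).

Let rr : R := r%:R.
Let ll : R := l%:~R.
Let uu : R := u%:~R.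
(** Margin of the induction. The base of a cone ending just past the right margin reaches left to at
    least k be + W - 4r, which is inside the left margin because 2W >= 4r; symmetrically on the
    other side. The half-width of the strip is 2W. *)
Let W : R := (2 * r + 1)%:R.
Let al := right_speed.
Let be := left_speed.

Let lR : - rr <= ll :> R.
Proof. by rewrite /rr /ll; move: l_ge; rewrite -(ler_int R) rmorphN. Qed.
Let luR : ll <= uu :> R. Proof. by rewrite /ll /uu ler_int. Qed.
Let uR : uu <= rr :> R.
Proof. by rewrite /rr /uu; move: u_le; rewrite -(ler_int R). Qed.
Let r0 : 0 <= rr :> R. Proof. exact: ler0n. Qed.
Ltac ctx_lra :=
  generalize c_ge c_le s_ge0 s_le1 lR luR uR r0; intros; lra.
Let bounded_mul (w v : R) : 0 <= w <= 1 -> - rr <= v <= rr ->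
  - rr <= w * v <= rr.
Proof.
move=> /andP[w0 w1] /andP[v1 v2]; rewrite -ler_norml normrM (ger0_norm w0).
by rewrite (le_trans (ler_piMl _ w1)) // ler_norml v1.
Qed.
Let al_le : al <= 1 + rr.
Proof.
have /andP[_ us] : - rr <= s * uu <= rr.
  by apply: bounded_mul; rewrite ?s_ge0 ?(le_trans lR luR).
have h1 : c + uu * s <= 1 + rr by ctx_lra.
have h2 : 0 <= 1 + rr :> R by ctx_lra.
by rewrite /al /right_speed ge_max h1 h2.
Qed.
Let be_ge : - (1 + rr) <= be.
Proof.
have /andP[ls _] : - rr <= s * ll <= rr.
  by apply: bounded_mul; rewrite ?s_ge0 ?(le_trans luR uR) ?lR.
have h1 : - (1 + rr) <= c + ll * s by ctx_lra.
have h2 : - (1 + rr) <= 0 :> R by ctx_lra.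
by rewrite /be /left_speed le_min h1 h2.
Qed.
Let al_ge0 : 0 <= al. Proof. by rewrite /al /right_speed le_max lexx orbT. Qed.
Let be_le0 : be <= 0. Proof. by rewrite /be /left_speed ge_min lexx orbT. Qed.
Let al_geu : c + uu * s <= al. Proof. by rewrite /al /right_speed le_max lexx. Qed.
Let be_lel : be <= c + ll * s. Proof. by rewrite /be /left_speed ge_min lexx. Qed.
Let WE : W = 2 * rr + 1. Proof. by rewrite /W natrD natrM. Qed.
Let W'E : (4 * r + 2)%:R = 4 * rr + 2 :> R. Proof. by rewrite natrD natrM. Qed.

Ltac speed_lra :=
  generalize al_le be_ge al_ge0 be_le0 al_geu be_lel WE W'E; intros; ctx_lra.

Let row_above (tau : R) : 0 <= tau -> exists j : nat, 0 <= j%:R - tau * s <= 1.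
Proof.
move=> tau0; have ts0 : 0 <= tau * s by rewrite mulr_ge0.
have cl0 : 0 <= Num.ceil (tau * s) by rewrite ceil_ge0; lra.
exists `|Num.ceil (tau * s)|%N.
have -> : (`|Num.ceil (tau * s)|%N)%:R = (Num.ceil (tau * s))%:~R :> R.
  by rewrite -[in RHS](gez0_abs cl0).
have := ceil_itv (tau * s); rewrite rmorphB /=; lra.
Qed.

Section Step.
Variable K : nat.
Hypothesis Kt : K.+1%:R <= t.
Hypothesis known : forall z : int, K%:R * be - W <= z%:~R <= K%:R * al + W ->
  Zdvd (p ^ a.+1) (x z).

Let k : R := K%:R.
Let K0 : 0 <= k. Proof. exact: ler0n. Qed.

Let KSE : K.+1%:R = k + 1 :> R. Proof. by rewrite -natr1. Qed.

Ltac step_lra := generalize K0; speed_lra.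

(* The site z is the extremal end of the dependency cone of (z - j u, j), a cell
   of the strip just above time K + 1; the other sites of this cone are
   already known to vanish. *)
Let step_right (d : nat) (z : int) :
  z <= Num.floor (k * al + W) + d%:Z ->
  k * be - W <= z%:~R <= K.+1%:R * al + W -> Zdvd (p ^ a.+1) (x z).
Proof.
(* [d] bounds the number of sites past the known interval, so the sites are treated going
   outwards. *)
elim: d z => [|d IH] z zd /andP[z1 z2].
  apply: known; rewrite z1 /=; move: zd; rewrite addr0 -(ler_int R) => /le_trans; apply.
  exact: floor_le.
have [zA|zA] := leP (z%:~R) (k * al + W); first by apply: known; rewrite z1.
have al0 : 0 < al by step_lra.
have alE : al = c + uu * s.
  by move: al0; rewrite /al /right_speed lt_max ltxx orbF => /ltW /max_idPl.
have [j /andP[j0 j1]] : exists j : nat, 0 <= j%:R - K.+1%:R * s <= 1.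
  exact: row_above.
(* In a horizontal direction the strip stays at row 0 and contains z itself. *)
case: (ltP 0 s) => [s0|s0]; last first.
  have sE : s = 0 by apply/eqP; rewrite eq_le s0.
  apply: (@vanish z 0%N K.+1%:R); first by rewrite ler0n.
    by rewrite ler_norml W'E; move: z2 zA; rewrite alE sE KSE; step_lra.
  by rewrite sE mulr0 subr0 lexx ler01.
have [e ce oe] := right_unit s0 al0.
set b := j%:R - K.+1%:R * s in j0 j1.
have jE : (j%:Z)%:~R = b + (k + 1) * s by rewrite -[LHS]/(j%:R) /b KSE subrK.
have bu : - rr <= b * uu <= rr.
  by apply: bounded_mul; rewrite ?j0 // (le_trans lR luR).
have bl : - rr <= b * ll <= rr.
  by apply: bounded_mul; rewrite ?j0 // lR (le_trans luR uR).
have zE : z = (z - j%:Z * u) + j%:Z * offset e by rewrite oe subrK.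
have nE : (z - j%:Z * u)%:~R = z%:~R - (b + (k + 1) * s) * uu :> R.
  by rewrite intrB intrM jE.
move: z2 zA; rewrite KSE alE => z2 zA.
rewrite zE; apply: (extremal_site m_gt1 p_pr unit_range dm xa ce); first by right.
  move=> v vb; rewrite -zE => vz.
  have vz' : v < z.
    by rewrite lt_neqAle vz; case/andP: vb => _; rewrite subrK.
  have vz2 : v%:~R <= z%:~R :> R by rewrite ler_int ltW.
  apply: IH; first by clear -zd vz'; lia.
  have : (z - j%:Z * u + j%:Z * l)%:~R <= v%:~R :> R.
    by rewrite ler_int; case/andP: vb.
  rewrite intrD nE intrM jE => vlow.
  have kb : k * be <= k * (c + ll * s) by rewrite ler_wpM2l.
  by rewrite KSE alE; apply/andP; split; step_lra.
apply: (@vanish _ _ K.+1%:R); rewrite ?ler0n ?j0 //.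
by rewrite ler_norml W'E nE KSE; apply/andP; split; step_lra.
Qed.

(** Mirror image of [step_right], with the cone of (z - j l, j). *)
Let step_left (d : nat) (z : int) :
  Num.ceil (k * be - W) - d%:Z <= z ->
  K.+1%:R * be - W <= z%:~R <= k * al + W -> Zdvd (p ^ a.+1) (x z).
Proof.
elim: d z => [|d IH] z zd /andP[z1 z2].
  apply: known; rewrite z2 andbT; move: zd; rewrite subr0 -(ler_int R).
  by apply: le_trans; exact: ceil_ge.
have [zA|zA] := leP (k * be - W) (z%:~R); first by apply: known; rewrite zA.
have be0 : be < 0 by step_lra.
have beE : be = c + ll * s.
  by move: be0; rewrite /be /left_speed gt_min ltxx orbF => /ltW /min_idPl.
have [j /andP[j0 j1]] : exists j : nat, 0 <= j%:R - K.+1%:R * s <= 1.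
  exact: row_above.
case: (ltP 0 s) => [s0|s0]; last first.
  have sE : s = 0 by apply/eqP; rewrite eq_le s0.
  apply: (@vanish z 0%N K.+1%:R); first by rewrite ler0n.
    by rewrite ler_norml W'E; move: z1 zA; rewrite beE sE KSE; step_lra.
  by rewrite sE mulr0 subr0 lexx ler01.
have [e ce oe] := left_unit s0 be0.
set b := j%:R - K.+1%:R * s in j0 j1.
have jE : (j%:Z)%:~R = b + (k + 1) * s by rewrite -[LHS]/(j%:R) /b KSE subrK.
have bu : - rr <= b * uu <= rr.
  by apply: bounded_mul; rewrite ?j0 // (le_trans lR luR).
have bl : - rr <= b * ll <= rr.
  by apply: bounded_mul; rewrite ?j0 // lR (le_trans luR uR).
have zE : z = (z - j%:Z * l) + j%:Z * offset e by rewrite oe subrK.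
have nE : (z - j%:Z * l)%:~R = z%:~R - (b + (k + 1) * s) * ll :> R.
  by rewrite intrB intrM jE.
move: z1 zA; rewrite KSE beE => z1 zA.
rewrite zE; apply: (extremal_site m_gt1 p_pr unit_range dm xa ce); first by left.
  move=> v vb; rewrite -zE => vz.
  have vz' : z < v.
    by rewrite lt_neqAle eq_sym vz; case/andP: vb; rewrite subrK.
  have vz2 : z%:~R <= v%:~R :> R by rewrite ler_int ltW.
  apply: IH; first by clear -zd vz'; lia.
  have : v%:~R <= (z - j%:Z * l + j%:Z * u)%:~R :> R.
    by rewrite ler_int; case/andP: vb.
  rewrite intrD nE intrM jE => vhi.
  have kb : k * (c + uu * s) <= k * al by rewrite ler_wpM2l.
  by rewrite KSE beE; apply/andP; split; step_lra.
apply: (@vanish _ _ K.+1%:R); rewrite ?ler0n ?j0 //.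
by rewrite ler_norml W'E nE KSE; apply/andP; split; step_lra.
Qed.

Lemma propagation_step (z : int) :
  K.+1%:R * be - W <= z%:~R <= K.+1%:R * al + W -> Zdvd (p ^ a.+1) (x z).
Proof.
move=> /andP[z1 z2]; have [zlo|zlo] := leP (k * be - W) z%:~R.
  (* Any sufficiently large depth serves; the absolute value avoids a case distinction. *)
  apply: (@step_right `|z - Num.floor (k * al + W)|%N);
    first by clear; lia.
  by rewrite zlo.
apply: (@step_left `|z - Num.ceil (k * be - W)|%N);
    first by clear; lia.
rewrite z1 (le_trans (ltW zlo)) //.
have kb : k * be <= 0 by rewrite mulr_ge0_le0.
have ka : 0 <= k * al by rewrite mulr_ge0.
by rewrite WE; step_lra.
Qed.

End Step.

Lemma propagation (K : nat) (z : int) : K%:R <= t ->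
  K%:R * left_speed <= z%:~R <= K%:R * right_speed -> Zdvd (p ^ a.+1) (x z).
Proof.
(* The induction has to carry the margin [W] on both sides; at K = 0 the enlarged interval lies in
   the strip at time 0. *)
move=> Kt zK; suff : forall z : int, K%:R * be - W <= z%:~R <= K%:R * al + W ->
    Zdvd (p ^ a.+1) (x z).
  by apply; move: zK; rewrite -/al -/be WE; speed_lra.
elim: K Kt {z zK} => [|K IH] Kt z.
  rewrite !mul0r sub0r add0r => zW.
  apply: (@vanish z 0%N 0); rewrite ?lexx // ?mul0r ?subr0 ?lexx ?ler01 //.
  by rewrite ler_norml W'E; move: zW; rewrite WE; speed_lra.
apply: propagation_step => //; apply: IH; apply: le_trans Kt.
by rewrite ler_nat.
Qed.

End Propagation.

(** * Counting patterns through finite encodings *)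

Lemma card_range_le (X : Type) (Y : choiceType) (F : finType) (f : X -> Y) (g : X -> F) :
  (forall x y, g x = g y -> f x = f y) ->
  finite_set (range f) /\ (#|` fset_set (range f)| <= #|F|)%N.
Proof.
move=> fg; have [[x0 _]|noX] := pselect (exists x : X, True); last first.
  have -> : range f = set0.
    by apply/seteqP; split => // y [x _ _]; apply: noX; exists x.
  by rewrite fset_set0 cardfs0; split => //; exact: finite_set0.
(* [h] factors f through g; off the image of g it takes the junk value [f x0], which is why an empty
   X is treated apart. *)
pose h v := if pselect (exists x, g x = v) is left e then f (projT1 (cid e)) else f x0.
have sub : (range f `<=` [set` [fset h v | v in F]%fset])%classic.
  move=> _ [x _ <-] /=; apply/imfsetP; exists (g x) => //.
  rewrite /h; case: pselect => [e|ne]; last by case: ne; exists x.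
  by case: cid => y /= /fg.
have fin : finite_set (range f) by exact: sub_finite_set sub (finite_fset _).
split=> //; rewrite [leqRHS]cardE; apply: leq_trans (leq_imfset_card imfset_key h (mem F)).
apply: fsubset_leq_card; apply/fsubsetP => y.
by rewrite in_fset_set // inE => /sub.
Qed.

(** Finiteness is assumed because [fset_set] sends an infinite set to the empty one. *)
Lemma card_range_ge (X : Type) (Y : choiceType) (F : finType) (f : X -> Y) (g : F -> X) :
  finite_set (range f) -> injective (f \o g) ->
  (#|F| <= #|` fset_set (range f)|)%N.
Proof.
move=> fin inj; rewrite cardE -(card_imfset imfset_key (mem F) inj).
apply: fsubset_leq_card; apply/fsubsetP => y /imfsetP[v _ ->].
by rewrite in_fset_set // inE; exists (g v).
Qed.

Section Patterns.
Variables (R : realType) (A : choiceType) (T : (int -> A) -> int -> A) (E : set (R * R)).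

Lemma patterns_eqP (x y : int -> A) :
  sigL (lattice_points E) (spacetime T x) = sigL (lattice_points E) (spacetime T y)
  <-> (forall (n : int) (j : nat), E (n%:~R, j%:R) -> iter j T x n = iter j T y n).
Proof.
split=> [xy n j Enj|xy].
  have Lnj : (n, j) \in lattice_points E by rewrite inE.
  exact: (congr1 (fun h => h (SigSub Lnj)) xy).
apply/funext => -[[n j] Lnj] /=.
by apply: xy; exact: set_mem Lnj.
Qed.

Lemma num_patterns_le (F : finType) (g : (int -> A) -> F) :
  (forall x y, g x = g y ->
     forall (n : int) (j : nat), E (n%:~R, j%:R) -> iter j T x n = iter j T y n) ->
  finite_set (range (fun x : int -> A => sigL (lattice_points E) (spacetime T x))) /\
  (num_patterns T E <= #|F|)%N.
Proof. by move=> gE; apply: (card_range_le (g := g)) => x y /gE /patterns_eqP. Qed.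

Lemma num_patterns_ge (F : finType) (g : F -> (int -> A)) :
  finite_set (range (fun x : int -> A => sigL (lattice_points E) (spacetime T x))) ->
  (forall v w, (forall (n : int) (j : nat), E (n%:~R, j%:R) ->
      iter j T (g v) n = iter j T (g w) n) -> v = w) ->
  (#|F| <= num_patterns T E)%N.
Proof. by move=> fin gE; apply: (card_range_ge (g := g)) => // v w /patterns_eqP /gE. Qed.

End Patterns.

Section ResidueTables.
Variables (h : nat) (q w : 'I_h -> nat).
(** The finite set behind both counting bounds: for each prime, a window of [w i] sites filled with
    residues modulo [q i]. *)
Definition tables := {dffun forall i : 'I_h, {ffun 'I_(w i) -> 'I_(q i)}}.

Lemma card_tables : #|{: tables}| = (\prod_(i < h) q i ^ w i)%N.
Proof.
rewrite card_dep_ffun foldrE big_image /=.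
by apply: eq_bigr => i _; rewrite card_ffun !card_ord.
Qed.
End ResidueTables.

Lemma eqn_mod_Gauss (d a b c : nat) : coprime d a ->
  (a * b == a * c %[mod d]) = (b == c %[mod d]).
Proof.
move=> da; wlog cb : b c / (c <= b)%N.
  by move=> H; have [|/ltnW] := leqP c b; [|rewrite eq_sym [RHS]eq_sym]; exact: H.
by rewrite !eqn_mod_dvd ?leq_mul2l ?cb ?orbT // -mulnBr Gauss_dvdr.
Qed.

Lemma ZdvdB_nat (m d a b : nat) : (1 < m)%N -> (d %| m)%N ->
  Zdvd d (a%:R - b%:R : 'Z_m) = (a == b %[mod d]).
Proof.
move=> m1 dm; wlog ba : a b / (b <= a)%N.
  move=> H; have [|/ltnW] := leqP b a; first exact: H.
  move=> /H; rewrite eq_sym => <-; rewrite -opprB.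
  by apply/idP/idP => /(ZdvdN m1 dm) //; rewrite opprK.
by rewrite -natrB // Zdvd_nat // eqn_mod_dvd.
Qed.

(** * Bounding the number of patterns by residue tables, from above and from below *)

Section Counting.
Variables (R : realType) (m h : nat) (p k : 'I_h -> nat).
Variables (r : nat) (lam : 'I_(2 * r).+1 -> 'Z_m).
Hypotheses (m_gt1 : (1 < m)%N) (p_prime : forall i, prime (p i)) (p_inj : injective p).
Hypothesis m_decomp : m = (\prod_(i < h) p i ^ k i)%N.
Variables (E : set (R * R)) (lo : 'I_h -> int) (w : 'I_h -> nat).

Let q i := (p i ^ k i)%N.

Let q_gt0 i : (0 < q i)%N. Proof. by rewrite expn_gt0 prime_gt0. Qed.

Let q_coprime i j : i != j -> coprime (q i) (q j).
Proof.
move=> ij; rewrite coprimeXl // coprimeXr // prime_coprime // dvdn_prime2 //.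
by apply: contraNN ij => /eqP /p_inj ->.
Qed.

Let cofactorE i : (m %/ q i)%N = (\prod_(j < h | j != i) q j)%N.
Proof.
have mE : m = (q i * \prod_(j < h | j != i) q j)%N by rewrite m_decomp (bigD1 i).
by rewrite [X in (X %/ _)%N]mE mulKn.
Qed.

Let q_dvd_m i : (q i %| m)%N.
Proof. by rewrite [X in (_ %| X)%N]m_decomp (bigD1 i) //= dvdn_mulr. Qed.

Let q_coprime_cofactor i : coprime (q i) (m %/ q i).
Proof.
rewrite cofactorE; elim/big_rec: _ => [|j n ji cn]; first exact: coprimen1.
by rewrite coprimeMr cn q_coprime // eq_sym.
Qed.

Let q_dvd_cofactor i j : i != j -> (q i %| m %/ q j)%N.
Proof. by move=> ij; rewrite cofactorE (bigD1 i) //= dvdn_mulr. Qed.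

Let eq0_Zdvd (x : 'Z_m) : (forall i, Zdvd (q i) x) -> x = 0.
Proof.
move=> qx; apply: Zdvd_max => //; rewrite /Zdvd [X in (X %| _)%N]m_decomp.
(* Uniqueness of the enumeration is carried along so that each [q i] stays coprime to the product of
   the later ones. *)
have : uniq (index_enum 'I_h) by exact: index_enum_uniq.
elim: (index_enum _) => [|i s IH] /=; first by rewrite big_nil dvd1n.
move=> /andP[si us]; rewrite big_cons Gauss_dvd ?IH ?andbT //; first exact: qx.
rewrite coprime_sym big_seq; elim/big_rec: _ => [|j n js cn]; first exact: coprime1n.
by rewrite coprimeMl cn q_coprime //; apply: contraNneq si => <-.
Qed.

Section Upper.
Variables (L Rt : 'I_h -> int).
Hypothesis unit_range :
  forall i e, coprime (lam e) (p i) -> L i <= offset e <= Rt i.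
Hypotheses (L_le : forall i, L i <= r%:Z) (R_ge : forall i, - r%:Z <= Rt i).
Hypothesis window : forall i (n : int) (j : nat), E (n%:~R, j%:R) ->
  lo i <= n + j%:Z * L i - (2 * r * k i)%:Z /\
  n + j%:Z * Rt i + (2 * r * k i)%:Z < lo i + (w i)%:Z.

Let residues (x : int -> 'Z_m) : tables q w :=
  [ffun i => [ffun d : 'I_(w i) =>
     Ordinal (ltn_pmod (x (lo i + d%:Z)) (q_gt0 i))]].

(** If two configurations have the same residues on all windows, [iter_locality] with a = k_i makes
    their difference evolve to 0 on E modulo every [q i], hence in ['Z_m]. *)
Lemma num_patterns_window :
  finite_set (range (fun x : int -> 'Z_m =>
    sigL (lattice_points E) (spacetime (linear_ca lam) x))) /\
  (num_patterns (linear_ca lam) E <= \prod_(i < h) q i ^ w i)%N.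
Proof.
rewrite -card_tables; apply: (num_patterns_le (g := residues)) => x y xy n j Enj.
apply/eqP; rewrite -subr_eq0; apply/eqP/eq0_Zdvd => i.
have <- := congr1 (fun f => f n) (iter_linear_caB lam j x y).
apply: (iter_locality m_gt1 (p_prime i) (unit_range (i := i))
  (L_le i) (R_ge i) (q_dvd_m i)) => u /andP[u1 u2].
have [w1 w2] := window i Enj.
have dw : (`|u - lo i| < w i)%N by lia.
have -> : u = lo i + (Ordinal dw)%:Z by rewrite /=; lia.
have := congr1 (fun f : tables q w => val (f i (Ordinal dw))) xy.
rewrite !ffunE /= => /eqP.
by rewrite -(ZdvdB_nat _ _ m_gt1) ?q_dvd_m // !natr_Zp.
Qed.

End Upper.

Section Lower.
Hypothesis determined : forall i a (x : int -> 'Z_m), (a < k i)%N ->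
  (forall v, Zdvd (p i ^ a) (x v)) ->
  (forall (n : int) (j : nat), E (n%:~R, j%:R) ->
     Zdvd (p i ^ a.+1) (iter j (linear_ca lam) x n)) ->
  forall z, lo i <= z < lo i + (w i)%:Z -> Zdvd (p i ^ a.+1) (x z).

Let coord (v : tables q w) (i : 'I_h) (n : int) : nat :=
  if lo i <= n then oapp (fun d => val (v i d)) 0%N (insub `|n - lo i|%N) else 0%N.

Let coordE v i (d : 'I_(w i)) : coord v i (lo i + d%:Z) = v i d.
Proof.
rewrite /coord; have -> : lo i <= lo i + d%:Z by lia.
by rewrite addrC addKr absz_nat valK.
Qed.

Let coord_out v i n : ~~ (lo i <= n < lo i + (w i)%:Z) -> coord v i n = 0%N.
Proof.
rewrite /coord; case: ifP => // ln nw.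
have nw' : (`|n - lo i| < w i)%N = false by lia.
by case: insubP => //= d; rewrite nw'.
Qed.

(** The cofactor m / q_i is divisible by every other [q j] and coprime to [q i]; so modulo [q i]
    only the i-th table is seen, up to a unit. *)
Let config (v : tables q w) (n : int) : 'Z_m :=
  \sum_(i < h) (m %/ q i * coord v i n)%:R.

Let config_mod v i n : Zdvd (q i) (config v n - (m %/ q i * coord v i n)%:R).
Proof.
rewrite /config (bigD1 i) //= addrC addrK; apply: Zdvd_sum => // j ji.
by rewrite Zdvd_nat // dvdn_mulr // q_dvd_cofactor // eq_sym.
Qed.

Lemma num_patterns_determined :
  finite_set (range (fun x : int -> 'Z_m =>
    sigL (lattice_points E) (spacetime (linear_ca lam) x))) ->
  (\prod_(i < h) q i ^ w i <= num_patterns (linear_ca lam) E)%N.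
Proof.
move=> fin; rewrite -card_tables.
apply: (num_patterns_ge (g := config)) => // v v' vv'.
pose x n := config v n - config v' n.
have xE i n : Zdvd (q i) (x n - ((m %/ q i * coord v i n)%:R -
    (m %/ q i * coord v' i n)%:R)).
  have swap (a b c d : 'Z_m) : (a - b) - (c - d) = (a - c) - (b - d) by ring.
  by rewrite /x swap; apply: ZdvdB => //; apply: config_mod.
have Tx n j : E (n%:~R, j%:R) -> iter j (linear_ca lam) x n = 0.
  by move=> Enj; rewrite iter_linear_caB vv' // subrr.
(* Climbing the filtration: inside the window [determined] gains one factor p_i, and outside it both
   tables read 0, so x is divisible by [q i] from the start. *)
have xdvd i a : (a <= k i)%N -> forall n, Zdvd (p i ^ a) (x n).
  elim: a => [|a IH] ak n; first by rewrite expn0 /Zdvd dvd1n.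
  case: (boolP (lo i <= n < lo i + (w i)%:Z)) => nw.
    apply: (determined ak (IH (ltnW ak)) _ nw) => u j /Tx ->.
    exact: Zdvd0.
  apply: (ZdvdW (dvdn_exp2l _ ak)).
  by have := xE i n; rewrite !coord_out // subrr subr0.
apply/ffunP => i; apply/ffunP => d; apply/val_inj.
have := xE i (lo i + d%:Z); rewrite !coordE => xd.
have := ZdvdB m_gt1 (q_dvd_m i) (xdvd i _ (leqnn _) (lo i + d%:Z)) xd.
(* The cofactor cancels modulo [q i], and the entries, being smaller than [q i], are equal. *)
rewrite subKr ZdvdB_nat // eqn_mod_Gauss ?q_coprime_cofactor //.
by rewrite !modn_small ?ltn_ord // => /eqP.
Qed.
End Lower.
End Counting.

(** * Growth rates as upper limits, and auxiliary estimates *)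

Section LimSup.
Variable R : realType.

Lemma limf_esup_pinfty_le (f : R -> R) (H C : R) :
  (forall t, 0 < t -> f t <= t * H + C) ->
  (limf_esup (fun t : R => (t^-1 * f t)%:E) (pinfty_nbhs R) <= H%:E)%E.
Proof.
move=> fH; apply/lee_addgt0Pr => e e0; apply: ereal_inf_le.
(* Beyond C / e the error C / t is below e; the maximum with 0 keeps t positive. *)
exists (ereal_sup [set (t^-1 * f t)%:E | t in [set t | Num.max 0 (C / e) < t]]%classic).
  exists [set t | Num.max 0 (C / e) < t]%classic => //.
  by exists (Num.max 0 (C / e)); split; first exact: num_real.
apply: ub_ereal_sup => _ [t /= tM <-]; move: tM; rewrite gt_max => /andP[t0 tC].
rewrite -EFinD lee_fin ler_pdivrMl // (le_trans (fH t t0)) // mulrDr lerD2l.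
by rewrite -ler_pdivrMr // ltW.
Qed.

Lemma limf_esup_pinfty_ge (f : R -> R) (H C : R) :
  (forall t, 0 < t -> t * H - C <= f t) ->
  (H%:E <= limf_esup (fun t : R => (t^-1 * f t)%:E) (pinfty_nbhs R))%E.
Proof.
move=> fH; apply: le_ereal_inf_tmp => _ [V [M [_ MV]] <-].
apply/lee_addgt0Pr => e e0.
(* One point of the given neighborhood of infinity at which C / t is below e. *)
pose t := Num.max (Num.max 0 M) (C / e) + 1.
have tm : Num.max (Num.max 0 M) (C / e) < t by rewrite ltrDl.
move: (tm); rewrite !gt_max => /andP[/andP[t0 tM] tC].
apply: (@le_trans _ _ ((t^-1 * f t)%:E + e%:E)%E).
  rewrite -EFinD lee_fin -lerBlDr ler_pdivlMl // (le_trans _ (fH t t0)) //.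
  by rewrite mulrBr lerD2l lerN2 -ler_pdivrMr // ltW.
by rewrite leeD2r //; apply: ereal_sup_ubound; exists t => //; exact: MV.
Qed.

Lemma bounded_set_pair (B : set (R * R)) : bounded_set B ->
  exists2 M : R, 0 <= M & forall b, B b -> `|b.1| <= M /\ `|b.2| <= M.
Proof.
move=> [M0 [_ HM]]; exists (`|M0| + 1); first by rewrite addr_ge0.
have M0M : M0 < `|M0| + 1 by rewrite (le_lt_trans (ler_norm _)) // ltrDl.
by move=> b Bb; have := HM _ M0M b Bb; rewrite /= prod_normE ge_max => /andP.
Qed.

Lemma ln_prod_pow (h : nat) (p k w : 'I_h -> nat) : (forall i, (0 < p i)%N) ->
  ln (\prod_(i < h) (p i ^ k i) ^ w i)%N%:R =
    \sum_(i < h) (w i)%:R * ((k i)%:R * ln (p i)%:R) :> R.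
Proof.
move=> p0; have q0 i : 0 < ((p i ^ k i) ^ w i)%N%:R :> R.
  by rewrite ltr0n !expn_gt0 p0.
rewrite natr_prod; elim: (index_enum _) => [|i s IH]; first by rewrite !big_nil ln1.
rewrite !big_cons lnM ?posrE // ?prodr_gt0 // IH; congr (_ + _).
by rewrite !natrX !lnXn ?exprn_gt0 ?ltr0n // !mulr_natl.
Qed.

End LimSup.

(** * The ends L and R of the set P *)

Section Ends.
Variables (m r : nat) (lam : 'I_(2 * r).+1 -> 'Z_m) (p : nat).

Lemma invertible_offsetsP (j : int) :
  reflect (exists2 e, coprime (lam e) p & offset e = j) (j \in invertible_offsets lam p).
Proof.
apply: (iffP mapP) => [[e]|[e ce <-]].
  by rewrite mem_filter => /andP[ce _] ->; exists e.
by exists e => //; rewrite mem_filter ce mem_enum.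
Qed.

Lemma bigmin_seq_mem (s : seq int) : \big[Num.min/0]_(j <- s) j \in 0 :: s.
Proof.
elim: s => [|i s IH]; first by rewrite big_nil mem_head.
rewrite big_cons minEle; case: ifP => _; first by rewrite !inE eqxx orbT.
by move: IH; rewrite !inE => /orP[->|->]; rewrite ?orbT.
Qed.

Lemma bigmax_seq_mem (s : seq int) : \big[Num.max/0]_(j <- s) j \in 0 :: s.
Proof.
elim: s => [|i s IH]; first by rewrite big_nil mem_head.
rewrite big_cons maxEle; case: ifP => _; last by rewrite !inE eqxx orbT.
by move: IH; rewrite !inE => /orP[->|->]; rewrite ?orbT.
Qed.

Lemma bigmin_seq_le (s : seq int) (j : int) : j \in s ->
  \big[Num.min/0]_(j <- s) j <= j.
Proof.
elim: s => [//|i s IH]; rewrite inE big_cons ge_min => /orP[/eqP ->|/IH ->].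
  by rewrite lexx.
by rewrite orbT.
Qed.

Lemma bigmax_seq_ge (s : seq int) (j : int) : j \in s ->
  j <= \big[Num.max/0]_(j <- s) j.
Proof.
elim: s => [//|i s IH]; rewrite inE big_cons le_max => /orP[/eqP ->|/IH ->].
  by rewrite lexx.
by rewrite orbT.
Qed.

Lemma L_end_le (j : int) : j \in P_set lam p -> L_end lam p <= j.
Proof. exact: bigmin_seq_le. Qed.

Lemma R_end_ge (j : int) : j \in P_set lam p -> j <= R_end lam p.
Proof. exact: bigmax_seq_ge. Qed.

Lemma L_end_mem : L_end lam p \in P_set lam p.
Proof.
have := bigmin_seq_mem (P_set lam p); rewrite inE => /orP[/eqP|//].
by rewrite /L_end => ->; rewrite mem_head.
Qed.

Lemma R_end_mem : R_end lam p \in P_set lam p.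
Proof.
have := bigmax_seq_mem (P_set lam p); rewrite inE => /orP[/eqP|//].
by rewrite /R_end => ->; rewrite mem_head.
Qed.

Lemma P_set_bound (j : int) : j \in P_set lam p -> - r%:Z <= j <= r%:Z.
Proof.
rewrite inE => /orP[/eqP ->|/invertible_offsetsP[e _ <-]]; first by lia.
exact: offset_bound.
Qed.

Lemma ends_range (e : 'I_(2 * r).+1) : coprime (lam e) p ->
  L_end lam p <= offset e <= R_end lam p.
Proof.
move=> ce; have eP : offset e \in P_set lam p.
  by rewrite inE; apply/orP; right; apply/invertible_offsetsP; exists e.
by rewrite L_end_le // R_end_ge.
Qed.

Lemma L_end_le0 : L_end lam p <= 0. Proof. by rewrite L_end_le // mem_head. Qed.
Lemma R_end_ge0 : 0 <= R_end lam p. Proof. by rewrite R_end_ge // mem_head. Qed.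

End Ends.

(** * The sector formulas in terms of the two speeds *)

Section Sectors.
Variables (R : realType) (theta : R).
Hypothesis theta_range : 0 <= theta <= pi.

(** With phi = atan j, the right-hand expression is cos(theta - phi) / cos phi, and theta - phi
    passes pi / 2 exactly at the angle of j. *)
Lemma le_theta_of (j : int) :
  (theta <= theta_of R j) = (0 <= cos theta + j%:~R * sin theta).
Proof.
rewrite /theta_of /arccot atanN opprK; set phi := atan _.
have phi1 : - (pi / 2) < phi by exact: atan_gtNpi2.
have phi2 : phi < pi / 2 by exact: atan_ltpi2.
have cphi : 0 < cos phi by apply: cos_gt0_pihalf; rewrite phi1.
have sphi : sin phi = j%:~R * cos phi.
  by rewrite -[j%:~R](@atanK R) -/phi /tan mulfVK // gt_eqF.
have -> : cos theta + j%:~R * sin theta = cos (theta - phi) / cos phi.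
  by rewrite cosB sphi; field; rewrite gt_eqF.
rewrite pmulr_lge0 ?invr_gt0 //; case/andP: theta_range => t0 tpi.
have pi2 : pi = pi / 2 + pi / 2 :> R by rewrite -splitr.
have [le|gt] := leP theta (pi / 2 + phi).
  by rewrite cos_ge0_pihalf //; apply/andP; split; lra.
(* Past the threshold, subtracting pi brings the angle back to (-pi/2, pi/2). *)
have : 0 < cos (theta - phi - pi) by apply: cos_gt0_pihalf; apply/andP; split; lra.
have -> : cos (theta - phi) = - cos (theta - phi - pi).
  by rewrite -cosDpi subrK.
by rewrite oppr_ge0 => ?; apply/esym/negbTE; rewrite -ltNge.
Qed.

(** By [le_theta_of] the sector tests are the signs of the two speeds before truncation at 0, so
    they decide how the maximum and the minimum evaluate. *)
Lemma h_sectorE (L U : int) (p k : nat) : L <= U ->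
  h_sector L U p k theta =
  k%:R * (right_speed U (cos theta) (sin theta)
          - left_speed L (cos theta) (sin theta)) * ln p%:R.
Proof.
move=> LU; have s0 : 0 <= sin theta by apply: sin_ge0_pi.
have LU' : L%:~R * sin theta <= U%:~R * sin theta by rewrite ler_wpM2r // ler_int.
rewrite /h_sector !le_theta_of /right_speed /left_speed.
have [L0|L0] := leP 0 (cos theta + L%:~R * sin theta).
  have U0 : 0 <= cos theta + U%:~R * sin theta by lra.
  by rewrite (max_idPl U0) subr0.
have [U0|U0] := leP 0 (cos theta + U%:~R * sin theta).
  by rewrite /h_middle rmorphB /=; ring.
by rewrite /h_last; ring.
Qed.

(** Makes adjacent formulas agree on their common ray: [h_sector] gives this ray to the earlier
    sector, while the sectors of the theorem are closed on both sides. *)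
Lemma theta_of_root (j : int) :
  cos (theta_of R j) + j%:~R * sin (theta_of R j) = 0.
Proof.
rewrite /theta_of /arccot atanN opprK (addrC (pi / 2)) cosDpihalf sinDpihalf.
set phi := atan _; have cphi : 0 < cos phi.
  by apply: cos_gt0_pihalf; rewrite atan_gtNpi2 atan_ltpi2.
by rewrite -[j%:~R](@atanK R) -/phi /tan mulfVK ?gt_eqF // addNr.
Qed.

Lemma theta_of_le (j : int) :
  theta_of R j <= theta -> cos theta + j%:~R * sin theta <= 0.
Proof.
rewrite le_eqVlt => /orP[/eqP <-|]; first by rewrite theta_of_root.
by rewrite ltNge le_theta_of -ltNge => /ltW.
Qed.

Lemma h_sector_middle (L U : int) (p k : nat) : L <= U ->
  theta_of R L <= theta -> theta <= theta_of R U ->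
  h_sector L U p k theta = h_middle L U p k theta.
Proof.
move=> LU /theta_of_le L0; rewrite le_theta_of => U0.
rewrite h_sectorE // /right_speed /left_speed (max_idPl U0) (min_idPl L0).
by rewrite /h_middle rmorphB /=; ring.
Qed.

Lemma h_sector_last (L U : int) (p k : nat) : L <= U ->
  theta_of R U <= theta -> h_sector L U p k theta = h_last L p k theta.
Proof.
move=> LU /theta_of_le U0; have s0 : 0 <= sin theta by apply: sin_ge0_pi.
have LU' : L%:~R * sin theta <= U%:~R * sin theta by rewrite ler_wpM2r // ler_int.
have L0 : cos theta + L%:~R * sin theta <= 0 by lra.
rewrite h_sectorE // /right_speed /left_speed (max_idPr U0) (min_idPl L0).
by rewrite /h_last; ring.
Qed.

Lemma h_sector_first (L U : int) (p k : nat) :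
  theta <= theta_of R L -> h_sector L U p k theta = h_first U p k theta.
Proof. by rewrite /h_sector => ->. Qed.

End Sectors.

(** * Both bounds for the entropy *)

Section Entropy.
Variables (R : realType) (m h : nat) (p k : 'I_h -> nat).
Variables (r : nat) (lam : 'I_(2 * r).+1 -> 'Z_m) (theta : R).
Hypotheses (m_gt1 : (1 < m)%N) (p_prime : forall i, prime (p i)) (p_inj : injective p).
Hypothesis m_decomp : m = (\prod_(i < h) p i ^ k i)%N.
Hypothesis theta_range : 0 <= theta <= pi.

Let L i := L_end lam (p i).
Let U i := R_end lam (p i).
Let c := cos theta.
Let s := sin theta.
Let al i := right_speed (U i) c s.
Let be i := left_speed (L i) c s.
Let H := \sum_(i < h) (al i - be i) * ((k i)%:R * ln (p i)%:R).

Let s0 : 0 <= s. Proof. exact: sin_ge0_pi. Qed.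
Let s1 : s <= 1. Proof. exact: sin_le1. Qed.
Let c0 : -1 <= c. Proof. exact: cos_geN1. Qed.
Let c1 : c <= 1. Proof. exact: cos_le1. Qed.
Let al_ge0 i : 0 <= al i. Proof. by rewrite /al /right_speed le_max lexx orbT. Qed.
Let be_le0 i : be i <= 0. Proof. by rewrite /be /left_speed ge_min lexx orbT. Qed.
Let al_ge i : c + (U i)%:~R * s <= al i.
Proof. by rewrite /al /right_speed le_max lexx. Qed.
Let be_le i : be i <= c + (L i)%:~R * s.
Proof. by rewrite /be /left_speed ge_min lexx. Qed.
Let weight_ge0 i : 0 <= (k i)%:R * ln (p i)%:R :> R.
Proof. by rewrite mulr_ge0 // ln_ge0 // ler1n prime_gt0. Qed.

Let L_bound i : - r%:Z <= L i <= 0.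
Proof. by rewrite /L L_end_le0; have /andP[-> _] := P_set_bound (L_end_mem lam (p i)). Qed.
Let U_bound i : 0 <= U i <= r%:Z.
Proof. by rewrite /U R_end_ge0; have /andP[_ ->] := P_set_bound (R_end_mem lam (p i)). Qed.

Lemma bounded_patterns (B : set (R * R)) : bounded_set B ->
  (B `<=` [set q | 0 <= q.2])%classic ->
  exists C, forall t, 0 < t ->
    finite_set (range (fun x : int -> 'Z_m =>
      sigL (lattice_points (sweep theta B t)) (spacetime (linear_ca lam) x))) /\
    ln (num_patterns (linear_ca lam) (sweep theta B t))%:R <= t * H + C.
Proof.
move=> /bounded_set_pair[M M0 BM] Bpos.
(* The three terms bound the horizontal position of a point of B, the cone spread due to its height,
   and the margin of [iter_locality] for a = k_i. *)
pose C i : R := M + M * r%:R + (2 * r * k i)%:R.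
have C_ge0 i : 0 <= C i by rewrite /C !addr_ge0 ?mulr_ge0.
(* The 3 covers the rounding of both window ends and the [+ 1] in [hi], which makes the half-open
   window contain its last required site. *)
exists (\sum_(i < h) (2 * C i + 3) * ((k i)%:R * ln (p i)%:R)) => t t0.
pose lo i := Num.floor (t * be i - C i).
pose hi i := Num.ceil (t * al i + C i) + 1.
pose w i := `|hi i - lo i|%N.
have lohi i : lo i <= hi i.
  have := floor_le (t * be i - C i); have := ceil_ge (t * al i + C i).
  have := C_ge0 i; have : t * be i <= 0 by rewrite mulr_ge0_le0 // ltW.
  have : 0 <= t * al i by rewrite mulr_ge0 // ltW.
  rewrite /hi /lo -(ler_int R) intrD => ? ? ? ? ?; lra.
have wE i : (w i)%:Z = hi i - lo i by rewrite /w gez0_abs // subr_ge0.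
have w_le i : (w i)%:R <= t * (al i - be i) + (2 * C i + 3).
  have -> : (w i)%:R = (hi i)%:~R - (lo i)%:~R :> R by rewrite -intrB -wE.
  have := floorD1_gt (t * be i - C i); have := ceil_itv (t * al i + C i).
  rewrite /hi /lo intrB !intrD => /andP[? ?] ?; lra.
have win i (n : int) (j : nat) : sweep theta B t (n%:~R, j%:R) ->
    lo i <= n + j%:Z * L i - (2 * r * k i)%:Z /\
    n + j%:Z * U i + (2 * r * k i)%:Z < lo i + (w i)%:Z.
  move=> [b Bb [tau /andP[tau0 taut] [nE jE]]].
  have [b1 b2] := BM b Bb; have b20 := Bpos b Bb; rewrite /= in b20.
  rewrite (ger0_norm b20) in b2; move: b1; rewrite ler_norml => /andP[b11 b12].
  have /andP[Lr L0] := L_bound i; have /andP[U0 Ur] := U_bound i.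
  have Lr' : - r%:R <= (L i)%:~R :> R by move: Lr; rewrite -(ler_int R) rmorphN.
  have L0' : (L i)%:~R <= 0 :> R by rewrite lerz0.
  have Ur' : (U i)%:~R <= r%:R :> R by move: Ur; rewrite -(ler_int R).
  have U0' : 0 <= (U i)%:~R :> R by rewrite ler0z.
  have bL : - (M * r%:R) <= b.2 * (L i)%:~R.
    rewrite -lerN2 opprK -mulrN; apply: ler_pM => //; first by rewrite oppr_ge0.
    by rewrite lerNl.
  have bU : b.2 * (U i)%:~R <= M * r%:R by apply: ler_pM.
  (* Since [be i] is at most 0 and [al i] at least 0, the widest window over all times tau <= t is
     the one at t. *)
  have tb : t * be i <= tau * (c + (L i)%:~R * s).
    apply: (@le_trans _ _ (tau * be i)); first by rewrite ler_wnM2r.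
    by rewrite ler_wpM2l.
  have ta : tau * (c + (U i)%:~R * s) <= t * al i.
    apply: (@le_trans _ _ (tau * al i)); first by rewrite ler_wpM2l.
    by rewrite ler_wpM2r.
  have jE' : (j%:Z)%:~R = b.2 + tau * s :> R by exact: jE.
  rewrite wE addrCA subrr addr0; split.
    rewrite -(ler_int R) (le_trans (floor_le _)) // intrB intrD intrM nE jE'.
    rewrite -[X in _ <= _ - X]/((2 * r * k i)%:R) /C -/c; lra.
  rewrite -(ltr_int R) /hi !intrD intrM nE jE'.
  apply: (@le_lt_trans _ _ (t * al i + C i)); last first.
    by rewrite (le_lt_trans (ceil_ge _)) // ltrDl.
  rewrite -[X in _ + X <= _]/((2 * r * k i)%:R) /C -/c; lra.
have L_le i : L i <= r%:Z by have := L_bound i; lia.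
have U_ge i : - r%:Z <= U i by have := U_bound i; lia.
have [fin N_le] := num_patterns_window m_gt1 p_prime p_inj m_decomp
  (fun i e => @ends_range m r lam (p i) e) L_le U_ge win.
split=> //.
have p_gt0 i : (0 < p i)%N by exact: prime_gt0.
have prod_gt0 : (0 < \prod_(i < h) (p i ^ k i) ^ w i)%N.
  by rewrite prodn_gt0 // => i; rewrite !expn_gt0 p_gt0.
apply: (@le_trans _ _ (ln (\prod_(i < h) (p i ^ k i) ^ w i)%N%:R)).
  (* A zero count is harmless because [ln 0] is 0. *)
  have [->|N0] := posnP (num_patterns (linear_ca lam) (sweep theta B t)).
    by rewrite ln0 // ln_ge0 // ler1n.
  by rewrite ler_ln ?posrE ?ltr0n // ler_nat.
rewrite ln_prod_pow // /H mulr_sumr -big_split /=.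
apply: ler_sum => i _.
by have := ler_wpM2r (weight_ge0 i) (w_le i); rewrite mulrDl -mulrA.
Qed.

(** Swept in the direction theta, this box covers the strip on which [propagation] assumes
    vanishing. *)
Let B0 : set (R * R) :=
  [set b | `|b.1| <= (4 * r + 2)%:R /\ 0 <= b.2 <= 1]%classic.

Lemma B0_bounded : bounded_set B0.
Proof.
exists (4 * r + 2)%:R; split; first exact: num_real.
move=> M rM b [b1 /andP[b20 b21]] /=; rewrite prod_normE ge_max.
rewrite (le_trans b1) ?(ltW rM) //= ger0_norm // (le_trans b21) //.
by rewrite ltW // (le_lt_trans _ rM) // ler1n addn2.
Qed.

Lemma B0_upper : (B0 `<=` [set q | 0 <= q.2])%classic.
Proof. by move=> b [_ /andP[]]. Qed.

Lemma sweep_B0 (t tau : R) (n : int) (j : nat) : 0 <= tau <= t ->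
  `|n%:~R - tau * c| <= (4 * r + 2)%:R -> 0 <= j%:R - tau * s <= 1 ->
  sweep theta B0 t (n%:~R, j%:R).
Proof.
move=> tt nb jb; exists (n%:~R - tau * c, j%:R - tau * s); first by split.
by exists tau => //=; rewrite !subrK.
Qed.

Hypothesis right_end : 0 < theta < pi / 2 -> forall i : 'I_h,
  exists2 j : int, j \in invertible_offsets lam (p i) & 0 <= j.
Hypothesis left_end : pi / 2 < theta < pi -> forall i : 'I_h,
  exists2 j : int, j \in invertible_offsets lam (p i) & j <= 0.

Let theta_inner : 0 < s -> 0 < theta < pi.
Proof.
case/andP: theta_range => t0 tp sp; rewrite !lt_neqAle t0 tp !andbT.
apply/andP; split; apply: contraTneq sp => tE; rewrite /s.
  by rewrite -tE sin0 ltxx.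
by rewrite tE sinpi ltxx.
Qed.

(** Otherwise U_i is the adjoined 0. Below pi / 2, [right_end] then gives a unit offset between 0
    and U_i = 0; from pi / 2 on, the speed cos theta is not positive. *)
Lemma right_unit i : 0 < s -> 0 < al i ->
  exists2 e, coprime (lam e) (p i) & offset e = U i.
Proof.
move=> /[dup] sp /theta_inner /andP[t0 tp].
rewrite /al /right_speed lt_max ltxx orbF => al0.
suff : U i \in invertible_offsets lam (p i) by move/invertible_offsetsP.
have := R_end_mem lam (p i); rewrite inE -/(U i) => /orP[/eqP U0|//].
have [tp2|tp2] := ltP theta (pi / 2).
  have [|j jI j0] := @right_end _ i; first by rewrite t0.
  have := @R_end_ge m r lam (p i) j; rewrite inE jI orbT -/(U i) U0 => /(_ isT) j0'.
  by rewrite (_ : 0 = j) //; apply/eqP; rewrite eq_le j0.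
move: al0; rewrite U0 mul0r addr0 => cp; exfalso.
have := pi_gt0 R => pi0; move: cp; rewrite /c -(@cos_pihalf R) ltr_cos ?in_itv /=.
- by rewrite ltNge tp2.
- by apply/andP; split; lra.
- by apply/andP; split; lra.
Qed.

(** Mirror image of [right_unit], with [left_end] used above pi / 2. *)
Lemma left_unit i : 0 < s -> be i < 0 ->
  exists2 e, coprime (lam e) (p i) & offset e = L i.
Proof.
move=> /[dup] sp /theta_inner /andP[t0 tp].
rewrite /be /left_speed gt_min ltxx orbF => be0.
suff : L i \in invertible_offsets lam (p i) by move/invertible_offsetsP.
have := L_end_mem lam (p i); rewrite inE -/(L i) => /orP[/eqP L0|//].
have [tp2|tp2] := ltP (pi / 2) theta.
  have [|j jI j0] := @left_end _ i; first by rewrite tp2.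
  have := @L_end_le m r lam (p i) j; rewrite inE jI orbT -/(L i) L0 => /(_ isT) j0'.
  by rewrite (_ : 0 = j) //; apply/eqP; rewrite eq_le j0'.
move: be0; rewrite L0 mul0r addr0 => cp; exfalso.
have := pi_gt0 R => pi0; move: cp; rewrite /c -(@cos_pihalf R) ltr_cos ?in_itv /=.
- by rewrite ltNge tp2.
- by apply/andP; split; lra.
- by apply/andP; split; lra.
Qed.

Lemma patterns_lower : exists C, forall t, 0 < t ->
  t * H - C <= ln (num_patterns (linear_ca lam) (sweep theta B0 t))%:R.
Proof.
(* The upper bound supplies the finiteness that counting from below requires. *)
have [C fin] := bounded_patterns B0_bounded B0_upper.
(* [al i - be i] is the loss from replacing t by its integer part, as [propagation] advances by unit
   times; 2 is the loss from rounding the window ends inwards. *)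
exists (\sum_(i < h) (al i - be i + 2) * ((k i)%:R * ln (p i)%:R)) => t t0.
pose K := `|Num.floor t|%N.
have KE : K%:R = (Num.floor t)%:~R :> R.
  by rewrite -[in RHS](@gez0_abs (Num.floor t)) // floor_ge0 ltW.
have Kt : K%:R <= t by rewrite KE floor_le.
have tK : t < K%:R + 1 by rewrite KE; have := floorD1_gt t; rewrite intrD.
pose lo i := Num.ceil (K%:R * be i).
pose hi i := Num.floor (K%:R * al i).
pose w i := `|hi i - lo i|%N.
have Kb i : K%:R * be i <= 0 by rewrite mulr_ge0_le0.
have Ka i : 0 <= K%:R * al i by rewrite mulr_ge0.
have lohi i : lo i <= hi i.
  by apply: (@le_trans _ _ 0); rewrite /lo /hi ?ceil_le0 ?floor_ge0.
have wE i : (w i)%:Z = hi i - lo i by rewrite /w gez0_abs // subr_ge0.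
have w_ge i : t * (al i - be i) - (al i - be i + 2) <= (w i)%:R.
  have -> : (w i)%:R = (hi i)%:~R - (lo i)%:~R :> R by rewrite -intrB -wE.
  have := floorD1_gt (K%:R * al i); have := ceil_itv (K%:R * be i).
  have : (t - 1) * (al i - be i) <= K%:R * (al i - be i).
    apply: ler_wpM2r; last by rewrite lerBlDr ltW.
    by rewrite subr_ge0 (le_trans (be_le0 i)).
  rewrite /hi /lo intrB intrD => ? /andP[? ?] ?; lra.
have det i a (x : int -> 'Z_m) : (a < k i)%N ->
    (forall v, Zdvd (p i ^ a) (x v)) ->
    (forall (n : int) (j : nat), sweep theta B0 t (n%:~R, j%:R) ->
       Zdvd (p i ^ a.+1) (iter j (linear_ca lam) x n)) ->
    forall z, lo i <= z < lo i + (w i)%:Z -> Zdvd (p i ^ a.+1) (x z).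
  move=> ak xa Tx z /andP[z1 z2].
  have dm : (p i ^ a.+1 %| m)%N.
    rewrite [X in (_ %| X)%N]m_decomp (bigD1 i) //=.
    by rewrite dvdn_mulr // dvdn_exp2l.
  have /andP[Lr L0] := L_bound i; have /andP[U0 Ur] := U_bound i.
  apply: (@propagation R m r (p i) lam (L i) (U i) c s t m_gt1 (p_prime i)
    (@ends_range m r lam (p i)) Lr (le_trans L0 U0) Ur c0 c1 s0 s1
    (@right_unit i) (@left_unit i) a x dm xa _ K z Kt).
    by move=> n j tau tt nb jb; apply: Tx; exact: sweep_B0 tt nb jb.
  rewrite -/(al i) -/(be i); apply/andP; split.
    by rewrite (le_trans (ceil_ge _)) // ler_int.
  rewrite (le_trans _ (floor_le _)) // ler_int ltW //.
  by move: z2; rewrite wE addrCA subrr addr0.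
have N_ge := num_patterns_determined m_gt1 p_prime p_inj m_decomp det (fin t t0).1.
have p_gt0 i : (0 < p i)%N by exact: prime_gt0.
have prod_gt0 : (0 < \prod_(i < h) (p i ^ k i) ^ w i)%N.
  by rewrite prodn_gt0 // => i; rewrite !expn_gt0 p_gt0.
apply: (@le_trans _ _ (ln (\prod_(i < h) (p i ^ k i) ^ w i)%N%:R)); last first.
  by rewrite ler_ln ?posrE ?ltr0n ?(leq_trans prod_gt0) // ler_nat.
rewrite ln_prod_pow // /H mulr_sumr -sumrB.
apply: ler_sum => i _.
by have := ler_wpM2r (weight_ge0 i) (w_ge i); rewrite mulrBl -mulrA.
Qed.

Lemma directional_entropyE :
  directional_entropy (linear_ca lam) theta =
  (\sum_(i < h) h_sector (L i) (U i) (p i) (k i) theta)%:E.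
Proof.
have -> : \sum_(i < h) h_sector (L i) (U i) (p i) (k i) theta = H.
  apply: eq_bigr => i _; rewrite h_sectorE //; last first.
    by have := L_bound i; have := U_bound i; lia.
  by rewrite -/c -/s -/(al i) -/(be i); ring.
apply/eqP; rewrite eq_le; apply/andP; split.
  apply: ub_ereal_sup => _ [B [Bb Bpos] <-].
  have [C BC] := bounded_patterns Bb Bpos.
  by apply: (@limf_esup_pinfty_le _ _ _ C) => t /BC[].
(* For the lower bound the single set [B0] suffices. *)
apply: (@le_trans _ _ (limf_esup (fun t : R => (t^-1 *
    ln (num_patterns (linear_ca lam) (sweep theta B0 t))%:R)%:E) (pinfty_nbhs R))).
  have [C BC] := patterns_lower.
  exact: (@limf_esup_pinfty_ge _ _ _ C).
apply: ereal_sup_ubound; exists B0 => //; split; first exact: B0_bounded.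
exact: B0_upper.
Qed.

End Entropy.

Theorem theorem4p2 (R : realType) (m h : nat) (p k : 'I_h -> nat)
    (r : nat) (lam : 'I_(2 * r).+1 -> 'Z_m) (theta : R)
    (m_ge2 : (2 <= m)%N)
    (p_prime : forall i, prime (p i))
    (p_inj : injective p)
    (k_gt0 : forall i, (0 < k i)%N)
    (m_decomp : m = (\prod_(i < h) p i ^ k i)%N)
    (theta_range : 0 <= theta <= pi)
    (right_end : 0 < theta < pi / 2 -> forall i : 'I_h,
       exists2 j : int, j \in invertible_offsets lam (p i) & 0 <= j)
    (left_end : pi / 2 < theta < pi -> forall i : 'I_h,
       exists2 j : int, j \in invertible_offsets lam (p i) & j <= 0) :
  let L := fun i : 'I_h => L_end lam (p i) in
  let Rt := fun i : 'I_h => R_end lam (p i) in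
  let ent := directional_entropy (linear_ca lam) theta in
  [/\ ent = (\sum_(i < h) h_sector (L i) (Rt i) (p i) (k i) theta)%:E,
      (forall i, theta <= theta_of R (L i)) ->
        ent = (\sum_(i < h) h_first (Rt i) (p i) (k i) theta)%:E,
      (forall j : 'I_h,
        (forall i, i != j -> theta_of R (L j) < theta_of R (L i)) ->
        theta_of R (L j) <= theta -> theta <= theta_of R (Rt j) ->
        (forall i, i != j -> theta <= theta_of R (L i)) ->
        ent = (\sum_(i < h | i != j) h_first (Rt i) (p i) (k i) theta
               + h_middle (L j) (Rt j) (p j) (k j) theta)%:E) &
      (forall i, theta_of R (Rt i) <= theta) ->
        ent = (\sum_(i < h) h_last (L i) (p i) (k i) theta)%:E].
Proof.
move=> L Rt ent; have LR i : L i <= Rt i.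
  exact: le_trans (L_end_le0 _ _) (R_end_ge0 _ _).
have entE : ent = (\sum_(i < h) h_sector (L i) (Rt i) (p i) (k i) theta)%:E.
  exact: directional_entropyE.
split=> //.
- move=> first; rewrite entE; congr EFin.
  by apply: eq_bigr => i _; exact: h_sector_first.
(* Only the summand of j has reached its middle sector, so it is split off. *)
- move=> j _ Lj jR first; rewrite entE (bigD1 j) //= addrC.
  rewrite (h_sector_middle theta_range (p j) (k j) (LR j) Lj jR) //; congr (_ + _)%:E.
  by apply: eq_bigr => i ij; apply: h_sector_first; exact: first.
- move=> last; rewrite entE; congr EFin.
  by apply: eq_bigr => i _; exact: h_sector_last.
Qed.
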